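(* For every integer $\tau\geq3$ and $\beta\in(0,1)$ there is a constant $\theta=\theta(\tau,\beta)>0$ such that the following holds. Let $\mathcal{C}$ be an ideal $\tau$-cover-minimal clutter over ground set $V$, and suppose the (real) rank of the set of vectors $\{\mathbf{1}_B:B\in b(\mathcal{C}),|B|=\tau\}$ is at most $(1-\beta)|V|$. Then $|\mathrm{core}(\mathcal{C})|\geq e^{\theta|V|}$.
   Context: A clutter over a finite ground set $V$ is a family $\mathcal{C}$ of subsets of $V$ (members) none of which contains another. $\mathcal{C}$ is ideal if the polyhedron $\{x\in\mathbb{R}^V_{\geq0}:\sum_{v\in C}x_v\geq1\ \forall C\in\mathcal{C}\}$ has only integral vertices. A cover is a set $B\subseteq V$ with $B\cap C\neq\emptyset$ for all $C\in\mathcal{C}$; $\tau(\mathcal{C})$ is the minimum size of a cover; the blocker $b(\mathcal{C})$ is the clutter of inclusion-wise minimal covers. For an integer $\tau\geq1$, $\mathcal{C}$ is $\tau$-cover-minimal if $\tau(\mathcal{C})=\tau$ and every element of $V$ lies in some minimum cover. For such $\mathcal{C}$, $\mathrm{core}(\mathcal{C})$ is the set of members of $\mathcal{C}$ intersecting every minimum cover exactly once. $\mathbf{1}_B$ denotes the indicator vector of $B$ in $\mathbb{R}^V$. *)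

(* Defs.v *)
From HB Require Import structures.
From mathcomp Require Import all_boot all_order all_algebra.
From mathcomp Require Import reals.

Set Implicit Arguments.
Unset Strict Implicit.
Unset Printing Implicit Defensive.

Import Order.TTheory GRing.Theory Num.Theory.

Local Open Scope ring_scope.

Section Clutter.
Variable V : finType.
Implicit Types (C : {set {set V}}) (A B : {set V}).

Definition clutter C : Prop :=
  forall A B, A \in C -> B \in C -> A \subset B -> A = B.

Definition is_cover C : pred {set V} :=
  fun B => [forall A in C, B :&: A != set0].

Definition blocker C : {set {set V}} := [set B | minset (is_cover C) B].

Definition is_min_cover C : pred {set V} :=
  fun B => is_cover C B && [forall B', is_cover C B' ==> (#|B| <= #|B'|)%N].

(* tau(C) = t, as a relation: tau(C) is undefined when the empty set is a
   member of C, since C then has no cover. *)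
Definition cover_number_is C (t : nat) : Prop :=
  exists2 B, is_min_cover C B & #|B| = t.

Definition cover_minimal (t : nat) C : Prop :=
  cover_number_is C t /\ forall v : V, exists2 B, is_min_cover C B & v \in B.

Definition core C : {set {set V}} :=
  [set A in C | [forall B, is_min_cover C B ==> (#|A :&: B| == 1)%N]].

End Clutter.

Section Polyhedron.
Variables (R : realType) (V : finType).
Implicit Types (C : {set {set V}}) (x y z : {ffun V -> R^o}).

Definition covering_polyhedron C x : Prop :=
  (forall v, 0 <= x v) /\ (forall A, A \in C -> 1 <= \sum_(v in A) x v).

(* The vertices of a polyhedron are its extreme points. *)
Definition vertex (P : {ffun V -> R^o} -> Prop) x : Prop :=
  P x /\ forall y z (t : R), P y -> P z -> 0 < t < 1 ->
    x = t *: y + (1 - t) *: z -> y = z.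

Definition ideal C : Prop :=
  forall x, vertex (covering_polyhedron C) x ->
    forall v, (x v : R) \is a Num.int.

Definition indic (B : {set V}) : {ffun V -> R^o} :=
  [ffun v => (v \in B)%:R].

Definition rank_blocker_of_size (t : nat) C : nat :=
  \dim <<[seq indic B | B in [set B in blocker C | #|B| == t]]>>%VS.

End Polyhedron.

(* Main.v *)
(** Let [U] be the span of the indicators of the minimum covers and [n = #|V|].
    Idealness makes every point of the covering polyhedron dominate a convex
    combination of covers; applied to a suitable combination of a vector [g] and
    the sum of all minimum covers, this shows that the l1 distance from [g] to [U]
    is at most [t * (t + 1)] times the maximum of [g(A) - g(V) / t] over the core
    members [A].

    Now let [g] be uniform on a centred grid with [M] values per coordinate, with
    [M] large depending on [beta].  By the Sauer-Shelah lemma the subspace [U], of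
    dimension at most [(1 - beta) * n], has at most [e^n * M^(dim U + 1)] roundings
    to the grid, so all but an exponentially small fraction of the grid points are
    at distance at least [beta / 8 * n] from [U].  Each of these has a core member
    [A] with [g(A) - g(V) / t >= eta * n], and for a fixed [A] this happens, by
    Chernoff, for an exponentially small fraction of the grid points only.  Hence
    there are exponentially many core members.  Small [n] is covered by
    [#|core C| >= 2]. *)

Require Import Defs.
From HB Require Import structures.
From mathcomp Require Import all_boot all_order all_algebra.
From mathcomp Require Import boolp reals sequences exp.
From mathcomp Require Import ring lra.

Set Implicit Arguments.
Unset Strict Implicit.
Unset Printing Implicit Defensive.

Import Order.TTheory GRing.Theory Num.Theory.

Local Open Scope ring_scope.

(** * Covering polyhedra of ideal clutters *)

Lemma ratio_test (R : realFieldType) (I : finType) (a b : I -> R) :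
  (forall i, 0 <= a i) -> (forall i, a i = 0 -> b i = 0) ->
  (exists i, b i < 0) ->
  exists s, [/\ 0 < s, forall i, 0 <= a i + s * b i &
    [set i | a i + s * b i != 0] \proper [set i | a i != 0]].
Proof.
move=> a0 ab [i0 bi0].
case: (@arg_minP _ _ _ i0 [pred i | b i < 0] (fun i => a i / - b i) bi0) => i /= bi imin.
have ai : a i != 0 by apply/eqP => /ab b0; rewrite b0 ltxx in bi.
(* The first time at which a nonzero coordinate of [a] reaches 0; coordinates already at 0 stay
   there. *)
exists (a i / - b i); split.
- by rewrite divr_gt0 ?oppr_gt0 // lt0r ai a0.
- move=> j; case: (ltrP (b j) 0) => bj.
    have := imin _ bj; rewrite ler_pdivlMr ?oppr_gt0 // => h; lra.
  by rewrite addr_ge0 // mulr_ge0 // divr_ge0 ?a0 // oppr_ge0 ltW.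
- rewrite properE; apply/andP; split.
    apply/subsetP => j; rewrite !inE; apply: contraNN => /eqP aj.
    by rewrite aj (ab _ aj) mulr0 addr0.
  apply/subsetPn; exists i; rewrite !inE // negbK.
  by apply/eqP; field; rewrite lt_eqF.
Qed.

Section Domination.
Variables (R : realType) (V : finType) (C : {set {set V}}).
Implicit Types x y z : {ffun V -> R^o}.

(** Membership in the convex hull of the covers plus the nonnegative orthant; the weights live on
    all subsets and vanish off the covers. *)
Definition dominates_covers x : Prop := exists lam : {set V} -> R,
  [/\ forall B, 0 <= lam B, forall B, lam B != 0 -> is_cover C B,
      \sum_B lam B = 1 & forall v, \sum_(B : {set V} | v \in B) lam B <= x v].

Lemma dominates_covers_le x y : (forall v, x v <= y v) ->
  dominates_covers x -> dominates_covers y.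
Proof.
move=> xy [lam [l0 lC l1 lx]]; exists lam; split=> // v.
exact: le_trans (lx v) (xy v).
Qed.

(** The weights are not normalised, so the step lengths of two opposite moves can be used
    directly. *)
Lemma dominates_covers_conv x y z (p q : R) : 0 < p -> 0 < q ->
  (forall v, (p + q) * z v = p * x v + q * y v) ->
  dominates_covers x -> dominates_covers y -> dominates_covers z.
Proof.
move=> p0 q0 zE [l [l0 lC l1 lx]] [m [m0 mC m1 my]].
have pq0 : 0 < p + q by rewrite addr_gt0.
exists (fun B => (p * l B + q * m B) / (p + q)); split.
- move=> B; rewrite divr_ge0 ?addr_ge0 // ?mulr_ge0 // ltW //.
- move=> B nz; have [lB|/lC//] := eqVneq (l B) 0.
  have [mB|/mC//] := eqVneq (m B) 0.
  by move: nz; rewrite lB mB !mulr0 addr0 mul0r eqxx.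
- by rewrite -mulr_suml big_split /= -!mulr_sumr l1 m1 !mulr1 divff // gt_eqF.
- move=> v; rewrite -mulr_suml big_split /= -!mulr_sumr ler_pdivrMr // mulrC.
  by rewrite mulrC [leRHS]mulrC zE lerD // ler_pM2l.
Qed.

(** The slacks of all inequalities as one family; a set outside [C] gets the dummy slack 0, whose
    slope is 0 too. *)
Definition constraint x (i : V + {set V}) : R := match i with
  | inl v => x v
  | inr A => if A \in C then \sum_(v in A) (x v : R) - 1 else 0
  end.

Definition constraint_slope x (i : V + {set V}) : R := match i with
  | inl v => x v
  | inr A => if A \in C then \sum_(v in A) (x v : R) else 0
  end.

Lemma constraintP x :
  covering_polyhedron C x <-> forall i, 0 <= constraint x i.
Proof.
split=> [[x0 xC] [v|A] /=|h]; first exact: x0.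
  by case: ifP => // /xC; rewrite subr_ge0.
by split=> [v|A CA]; [exact: (h (inl v))|move: (h (inr A)); rewrite /= CA subr_ge0].
Qed.

Lemma constraintD x w (s : R) i :
  constraint (x + s *: w) i = constraint x i + s * constraint_slope w i.
Proof.
case: i => [v|A] /=; first by rewrite !ffunE.
case: ifP => _; last by rewrite mulr0 addr0.
under eq_bigr do rewrite !ffunE.
by rewrite big_split /= -mulr_sumr; ring.
Qed.

Lemma constraint_slopeN w i : constraint_slope (- w) i = - constraint_slope w i.
Proof.
case: i => [v|A] /=; first by rewrite !ffunE.
case: ifP => _; last by rewrite oppr0.
by under eq_bigr do rewrite !ffunE; rewrite sumrN.
Qed.

(* A non-extreme point is moved along a segment of the polyhedron, in the
   direction(s) that meet the nonnegativity constraints, until a further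
   constraint becomes tight; the recession cone consists of nonnegative
   vectors, which domination absorbs. *)
Lemma ideal_dominates_covers x :
  ideal R C -> covering_polyhedron C x -> dominates_covers x.
Proof.
move=> idC.
(* Induction on the number of constraints that are not tight. *)
have [n] := ubnP #|[set i | constraint x i != 0]|.
elim: n x => // n IH x; rewrite ltnS => xn xP.
have [vx|nvx] := pselect (vertex (covering_polyhedron C) x).
  have xi := idC x vx; have [x0 xC] := xP.
  have x1 v : x v != 0 -> 1 <= x v.
    have int_ge1 (r : R) : r \is a Num.int -> r != 0 -> 0 <= r -> 1 <= r.
      by move=> /intrP [k ->]; rewrite intr_eq0 ler0z ler1z; case: k => [[|k]|k].
    by move=> xv; apply: int_ge1 xv (x0 v); exact: xi.
  (* The support of an integral vertex is a cover and carries all the weight. *)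
  pose S := [set v | x v != 0].
  exists (fun B => (B == S)%:R); split.
  - by move=> B; rewrite ler0n.
  - move=> B; rewrite pnatr_eq0 eqb0 negbK => /eqP ->.
    apply/forall_inP => A CA; apply/eqP => SA.
    have := xC A CA; rewrite big1 ?ler10 // => v vA; apply/eqP/negPn/negP => xv.
    by have := in_set0 v; rewrite -SA !inE xv vA.
  - by rewrite (bigD1 S) //= eqxx big1 ?addr0 // => B /negbTE ->.
  - move=> v; case: (boolP (v \in S)) => vS.
      rewrite (bigD1 S) //= eqxx big1 ?addr0; last by move=> B /andP[_ /negbTE ->].
      by apply: x1; rewrite inE in vS.
    rewrite big1 // => B vB; case: eqP => // BS; by rewrite -BS vB in vS.
have [y [z [t [yP zP t01 xE yz]]]] : exists y z (t : R),
    [/\ covering_polyhedron C y, covering_polyhedron C z, 0 < t < 1,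
     x = t *: y + (1 - t) *: z & y <> z].
  apply: contrapT => H; apply: nvx; split=> // y z t yP zP t01 xE.
  by apply: contrapT => yz; apply: H; exists y, z, t.
have step w : (forall i, constraint x i = 0 -> constraint_slope w i = 0) ->
    (exists v, w v < 0) ->
    exists s : R, 0 < s /\ dominates_covers (x + s *: w).
  move=> tight [v wv].
  have [|||s [s0 sP slt]] := @ratio_test _ _ (constraint x) (constraint_slope w).
  - exact/constraintP.
  - by [].
  - by exists (inl v).
  exists s; split=> //; apply: IH.
    apply: leq_trans (proper_card _) xn.
    by under eq_finset do rewrite constraintD.
  by apply/constraintP => i; rewrite constraintD.
(* A constraint tight at [x], inside the segment from [z] to [y], is tight at both ends, hence
   constant along it. *)
have tight i : constraint x i = 0 -> constraint_slope (y - z) i = 0.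
  have /andP[t0 t1] := t01.
  have yi := (constraintP y).1 yP i; have zi := (constraintP z).1 zP i.
  have yzi : constraint y i = constraint z i + constraint_slope (y - z) i.
    by rewrite -[constraint_slope _ _]mul1r -constraintD scale1r addrC subrK.
  have -> : x = z + t *: (y - z).
    by rewrite xE; apply/ffunP => v; rewrite !ffunE /GRing.scale /=; ring.
  rewrite constraintD; nra.
have tightN i : constraint x i = 0 -> constraint_slope (- (y - z)) i = 0.
  by move=> /tight h; rewrite constraint_slopeN h oppr0.
(* If only one of the two directions has a negative coordinate, moving along it only decreases [x];
   if neither has one, then [y = z]. *)
have [neg|nneg] := pselect (exists v, (y - z) v < 0);
have [pos|npos] := pselect (exists v, (- (y - z)) v < 0).
- have [s [s0 sd]] := step _ tight neg.
  have [r [r0 rd]] := step _ tightN pos.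
  apply: (dominates_covers_conv r0 s0 _ sd rd) => v.
  by rewrite !ffunE /GRing.scale /=; ring.
- have [s [s0 sd]] := step _ tight neg.
  apply: dominates_covers_le sd => v; rewrite ffunE gerDl ffunE.
  rewrite pmulr_rle0 // leNgt; apply/negP => h; apply: npos; exists v.
  by rewrite ffunE oppr_lt0.
- have [s [s0 sd]] := step _ tightN pos.
  apply: dominates_covers_le sd => v; rewrite ffunE gerDl ffunE.
  rewrite pmulr_rle0 // leNgt; apply/negP => h; apply: nneg; exists v.
  by rewrite ffunE oppr_gt0 in h.
- exfalso; apply: yz; apply/ffunP => v; apply/eqP; rewrite eq_le; apply/andP; split.
    rewrite leNgt; apply/negP => h; apply: npos; exists v.
    by rewrite !ffunE oppr_lt0 subr_gt0.
  rewrite leNgt; apply/negP => h; apply: nneg; exists v.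
  by rewrite !ffunE subr_lt0.
Qed.

End Domination.

(** * The span of the minimum covers and its l1 distance from a vector *)

Section CoreDistance.
Variables (R : realType) (V : finType) (C : {set {set V}}) (t : nat).
Hypotheses (idC : ideal R C) (cmC : cover_minimal t C).

(** The space whose dimension is [rank_blocker_of_size]. *)
Definition min_cover_space : {vspace {ffun V -> R^o}} :=
  <<[seq indic R B | B in [set B in blocker C | #|B| == t]]>>%VS.

Lemma card_min_cover B : is_min_cover C B -> #|B| = t.
Proof.
case: cmC => [[D /andP[Dc /forall_inP Dm] <-] _] /andP[Bc /forall_inP Bm].
by apply/eqP; rewrite eqn_leq Bm ?Dm.
Qed.

Lemma card_cover_gt B : is_cover C B -> ~~ is_min_cover C B -> (t < #|B|)%N.
Proof.
case: cmC => [[D /andP[Dc /forall_inP Dm] <-] _] Bc; apply: contraR.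
rewrite -leqNgt => BD; rewrite /is_min_cover Bc; apply/forall_inP => E Ec.
exact: leq_trans BD (Dm E Ec).
Qed.

Lemma indic_min_cover B : is_min_cover C B -> indic R B \in min_cover_space.
Proof.
move=> Bm; apply: memv_span; apply: image_f; rewrite inE card_min_cover // eqxx andbT.
rewrite inE; apply/minsetP; split; first by case/andP: Bm.
move=> E Ec EB; apply/eqP; rewrite eqEcard EB.
by case/andP: Bm => _ /forall_inP; apply.
Qed.

Lemma sum_indic (A B : {set V}) :
  \sum_(v in A) (indic R B v : R) = #|A :&: B|%:R.
Proof.
under eq_bigr do rewrite ffunE.
by rewrite -natr_sum -big_mkcondr /= sum1_card; congr _%:R; apply: eq_card => v; rewrite !inE.
Qed.

(* LP duality in disguise: with [s] the sum of the indicators of the minimum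
   covers and [L] large, [L *: s - g] is, up to scaling, a point of the covering
   polyhedron, so it dominates a combination of covers; the covers that are not
   minimum contribute more than [t] each, which bounds their total weight. *)
Lemma core_l1_distance (g : V -> R) (gam : R) :
  (forall A, A \in core C -> \sum_(v in A) g v <= gam) ->
  exists2 u, u \in min_cover_space &
    \sum_v `|g v - u v| <= t.+1%:R * (t%:R * gam - \sum_v g v).
Proof.
move=> gcore.
pose s v : R := \sum_(B | is_min_cover C B) indic R B v.
pose m : R := \sum_(B | is_min_cover C B) 1.
have sA (A : {set V}) : \sum_(v in A) s v = \sum_(B | is_min_cover C B) #|A :&: B|%:R.
  by rewrite exchange_big; apply: eq_bigr => B _; rewrite sum_indic.
have sV : \sum_v s v = t%:R * m.
  have -> : \sum_v s v = \sum_(v in setT) s v by apply: eq_bigl => v; rewrite inE.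
  rewrite sA mulr_sumr; apply: eq_bigr => B /card_min_cover <-.
  by rewrite setTI mulr1.
have s1 v : 1 <= s v.
  case: cmC => _ /(_ v) [B Bm vB]; rewrite /s (bigD1 B) //= ffunE vB lerDl.
  by apply: sumr_ge0 => D _; rewrite ffunE ler0n.
have m1 : 1 <= m.
  case: cmC => [[B Bm _] _]; rewrite /m (bigD1 B) //= lerDl.
  by apply: sumr_ge0 => D _; rewrite ler01.
(* A member outside the core meets some minimum cover at least twice; core members get exactly [m].
   A large [L] exploits this gap. *)
have sC (A : {set V}) : A \in C -> A \notin core C -> m + 1 <= \sum_(v in A) s v.
  move=> CA; rewrite inE CA negb_forall => /existsP [B].
  rewrite negb_imply => /andP[Bm AB1].
  have AB (D : {set V}) : is_min_cover C D -> (0 < #|A :&: D|)%N.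
    case/andP => /forall_inP /(_ A CA); rewrite setIC -card_gt0 //.
  have AB2 : (1 < #|A :&: B|)%N by rewrite ltn_neqAle eq_sym AB1 AB.
  rewrite sA /m (bigD1 B) // [leRHS](bigD1 B) //= addrAC lerD //.
    by rewrite -(natrD _ 1 1) ler_nat.
  by apply: ler_sum => D /andP[Dm _]; rewrite ler1n AB.
have sK (A : {set V}) : A \in core C -> \sum_(v in A) s v = m.
  rewrite inE => /andP[_ /forall_inP h]; rewrite sA; apply: eq_bigr => B /h /eqP ->.
  by [].
pose G := \sum_v `|g v|.
have G0 : 0 <= G by apply: sumr_ge0 => v _; exact: normr_ge0.
have gG (A : {set V}) : \sum_(v in A) g v <= G.
  apply: (@le_trans _ _ (\sum_(v in A) `|g v|)).
    by apply: ler_sum => v _; exact: ler_norm.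
  rewrite /G [leRHS](bigID (mem A)) /= lerDl.
  by apply: sumr_ge0 => v _; exact: normr_ge0.
have gv v : g v <= G.
  have -> : g v = \sum_(w in [set v]) g w by rewrite big_set1.
  exact: gG.
(* This [L] makes [K] positive and [L * s - g] nonnegative, and settles the members outside the
   core; for core members the choice of [K] turns [gcore] into the constraint. *)
pose L := 1 + `|gam| + G; pose K := L * m - gam.
have ga := ler_norm gam; have ga0 := normr_ge0 gam; have gaN := ler_norm (- gam).
rewrite normrN in gaN.
have L1 : 1 <= L by rewrite /L; lra.
have Lm : L <= L * m by rewrite ler_peMr //; lra.
have K0 : 0 < K by rewrite /K; rewrite /L in Lm *; lra.
pose al : {ffun V -> R^o} := [ffun v => (L * s v - g v) / K].
have alP : covering_polyhedron C al.
  split=> [v|A CA].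
    rewrite ffunE divr_ge0 ?(ltW K0) // subr_ge0.
    apply: (@le_trans _ _ L); last by rewrite ler_peMr //; lra.
    by apply: le_trans (gv v) _; rewrite /L; lra.
  under eq_bigr do rewrite ffunE.
  rewrite -mulr_suml ler_pdivlMr // mul1r sumrB -mulr_sumr.
  case: (boolP (A \in core C)) => Ac.
    by rewrite sK // /K lerD // lerN2 gcore.
  have h1 := gG A; have h2 : L * (m + 1) <= L * \sum_(v in A) s v.
    by rewrite ler_pM2l ?sC //; lra.
  by rewrite /K; rewrite mulrDr mulr1 /L in h2; rewrite /L; lra.
have [lam [l0 lC l1 lal]] := ideal_dominates_covers idC alP.
pose N := \sum_(B | ~~ is_min_cover C B) lam B.
have lmin : \sum_(B | is_min_cover C B) lam B = 1 - N.
  by rewrite -l1 [X in _ = X - _](bigID (is_min_cover C)) /= addrK.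
(* From [L * s] the share of minimum covers in [K] times the combination is removed; the rest
   exceeds [g] by at least the share of the other covers. *)
pose u : {ffun V -> R^o} := \sum_(B | is_min_cover C B) (L - K * lam B) *: indic R B.
have uE v : u v = L * s v - K * \sum_(B | is_min_cover C B) lam B * (v \in B)%:R.
  rewrite /u sum_ffunE /s !mulr_sumr -sumrB; apply: eq_bigr => B _.
  by rewrite !ffunE /GRing.scale /=; ring.
have hv v : K * \sum_(B | ~~ is_min_cover C B) lam B * (v \in B)%:R <= u v - g v.
  have := lal v; rewrite ffunE ler_pdivlMr // uE.
  rewrite (_ : \sum_(B | _) lam B = \sum_B lam B * (v \in B)%:R).
    rewrite (bigID (is_min_cover C)) /= => h; lra.
  rewrite [LHS]big_mkcond; apply: eq_bigr => B _; case: ifP => _; by rewrite ?mulr1 ?mulr0.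
have hv0 v : 0 <= u v - g v.
  apply: le_trans (hv v); rewrite mulr_ge0 ?(ltW K0) //.
  by apply: sumr_ge0 => B _; rewrite mulr_ge0.
have sum_in (P : pred {set V}) : \sum_v \sum_(B | P B) lam B * (v \in B)%:R =
    \sum_(B | P B) lam B * #|B|%:R.
  rewrite exchange_big; apply: eq_bigr => B _; rewrite -mulr_sumr; congr (_ * _).
  by rewrite -natr_sum -big_mkcond sum1_card.
have sumh : \sum_v (u v - g v) = t%:R * gam - \sum_v g v + t%:R * (K * N).
  rewrite sumrB; under eq_bigr do rewrite uE.
  rewrite sumrB -!mulr_sumr sV sum_in.
  rewrite (eq_bigr (fun B => lam B * t%:R)); last by move=> B /card_min_cover ->.
  by rewrite -mulr_suml lmin /K; ring.
(* The other covers have at least [t + 1] elements. With [sumh] this gives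
   [K * N <= t * gam - g(V)], hence the factor [t + 1] of the bound. *)
have leh : t.+1%:R * (K * N) <= \sum_v (u v - g v).
  apply: (@le_trans _ _ (\sum_v K * \sum_(B | ~~ is_min_cover C B) lam B * (v \in B)%:R)).
    rewrite -mulr_sumr sum_in mulrCA ler_pM2l // mulr_sumr.
    apply: ler_sum => B Bm; have [->|/lC Bc] := eqVneq (lam B) 0; first by rewrite mulr0 mul0r.
    by rewrite mulrC ler_wpM2l // ler_nat card_cover_gt.
  by apply: ler_sum.
exists u.
  by apply: memv_suml => B Bm; apply: memvZ; exact: indic_min_cover.
rewrite (eq_bigr (fun v => u v - g v)); last by move=> v _; rewrite distrC ger0_norm.
rewrite sumh in leh *; rewrite -[t.+1]addn1 natrD in leh *.
have t0 : 0 <= t%:R :> R by rewrite ler0n.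
nra.
Qed.

(** For a core with at most one member, some [g] with [gam = -1] makes the distance bound negative:
    [g = 0] if the core is empty, minus the indicator of a point of [A] if the core is [{A}]. *)
Lemma core_ge2 : (1 < t)%N -> (2 <= #|core C|)%N.
Proof.
move=> t1; have t1R : 1 < t%:R :> R by rewrite ltr1n.
have ge0 u (g : V -> R) : 0 <= \sum_v `|g v - u v| :> R.
  by apply: sumr_ge0 => v _; exact: normr_ge0.
rewrite ltnNge; apply/negP; rewrite leq_eqVlt ltnS leqn0 cards_eq0.
case/orP => [/cards1P [A coreA]|/eqP core0].
  have Ac : A \in core C by rewrite coreA inE.
  case: cmC => [[B Bm _] _].
  have /card_gt0P [v] : (0 < #|A :&: B|)%N.
    by move: Ac; rewrite inE => /andP[_ /forall_inP /(_ B Bm) /eqP ->].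
  rewrite inE => /andP[vA _].
  pose g w : R := - (w == v)%:R.
  have [|u _] := @core_l1_distance g (-1).
    move=> D; rewrite coreA inE => /eqP ->.
    by rewrite (bigD1 v) //= big1 /g ?eqxx ?addr0 // => w /andP[_ /negbTE ->]; rewrite oppr0.
  have -> : \sum_w g w = -1.
    by rewrite (bigD1 v) //= big1 /g ?eqxx ?addr0 // => w /negbTE ->; rewrite oppr0.
  move/(le_trans (ge0 _ _)); rewrite pmulr_rge0 ?ltr0n //; lra.
have [|u _] := @core_l1_distance (fun _ => 0) (-1); first by move=> A; rewrite core0 inE.
move/(le_trans (ge0 _ _)); rewrite pmulr_rge0 ?ltr0n // big1 //; lra.
Qed.

End CoreDistance.

(** * Shattering and the Sauer-Shelah lemma *)

Section SauerShelah.
Variable Y : finType.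
Implicit Types (F : {set {set Y}}) (S T : {set Y}).

Definition shatters F S :=
  [forall T : {set Y}, (T \subset S) ==> [exists A in F, A :&: S == T]].

Lemma shattersP F S :
  reflect (forall T, T \subset S -> exists2 A, A \in F & A :&: S = T)
          (shatters F S).
Proof.
apply: (iffP forall_inP) => h T TS.
  by have /exists_inP [A AF /eqP AS] := h T TS; exists A.
by have [A AF AS] := h T TS; apply/exists_inP; exists A => //; apply/eqP.
Qed.

Lemma shatters_sub F F' S : F \subset F' -> shatters F S -> shatters F' S.
Proof.
move=> /subsetP FF' /shattersP h; apply/shattersP => T /h [A AF AS].
by exists A; rewrite ?FF'.
Qed.

(** Pajor's form, by induction after splitting [F] at an element [y]. A set shattered by both halves
    avoids [y], and adding [y] to it gives a set shattered by [F] but by neither half. *)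
Lemma sauer_shelah F : (#|F| <= #|[set S | shatters F S]|)%N.
Proof.
have [n] := ubnP #|F|; elim: n F => // n IH F; rewrite ltnS => Fn.
have [F1|] := leqP #|F| 1.
  have [->|[A AF]] := set_0Vmem F; first by rewrite cards0.
  apply: leq_trans F1 _; rewrite card_gt0; apply/set0Pn; exists set0.
  rewrite inE; apply/shattersP => T; rewrite subset0 => /eqP ->.
  by exists A => //; rewrite setI0.
case/card_gt1P => A [B [AF BF AB]].
have [y yAB] : exists y, (y \in A) != (y \in B).
  apply/existsP; apply: contraR AB; rewrite negb_exists => /forallP h.
  by apply/eqP/setP => y; have := h y; rewrite negbK => /eqP.
pose F1 := [set D in F | y \in D]; pose F0 := [set D in F | y \notin D].
have sF1 : F1 \subset F by apply/subsetP => D; rewrite inE => /andP[].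
have sF0 : F0 \subset F by apply/subsetP => D; rewrite inE => /andP[].
have cF : #|F| = (#|F1| + #|F0|)%N.
  rewrite -(cardsID [set D : {set Y} | y \in D] F); congr (_ + _)%N; apply: eq_card => D;
  by rewrite !inE // andbC.
have [F1p F0p] : (0 < #|F1| /\ 0 < #|F0|)%N.
  rewrite !card_gt0; split; apply/set0Pn.
    case: (boolP (y \in A)) => yA; first by exists A; rewrite inE AF.
    by exists B; rewrite inE BF; move: yAB; rewrite (negbTE yA); case: (y \in B).
  case: (boolP (y \in A)) => yA; last by exists A; rewrite inE AF.
  by exists B; rewrite inE BF; move: yAB; rewrite yA; case: (y \in B).
have IH1 : (#|F1| <= #|[set S | shatters F1 S]|)%N.
  by apply: IH; apply: leq_trans Fn; rewrite cF -addn1 leq_add2l.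
have IH0 : (#|F0| <= #|[set S | shatters F0 S]|)%N.
  by apply: IH; apply: leq_trans Fn; rewrite cF -add1n leq_add2r.
have ny1 S : shatters F1 S -> y \notin S.
  move=> /shattersP /(_ set0 (sub0set _)) [D]; rewrite inE => /andP[_ yD] DS.
  by apply/negP => yS; have := in_set0 y; rewrite -DS inE yD yS.
have ny0 S : shatters F0 S -> y \notin S.
  move=> /shattersP /(_ S (subxx _)) [D]; rewrite inE => /andP[_ yD] DS.
  by rewrite -DS inE (negbTE yD).
pose S1 := [set S | shatters F1 S]; pose S0 := [set S | shatters F0 S].
pose S2 := [set y |: S | S in S1 :&: S0].
have cS2 : #|S2| = #|S1 :&: S0|.
  rewrite card_in_imset // => S T; rewrite !inE => /andP[/ny1 yS _] /andP[/ny1 yT _].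
  by move=> ST; rewrite -(setU1K yS) ST setU1K.
rewrite cF; apply: leq_trans (leq_add IH1 IH0) _.
rewrite -/S1 -/S0 -cardsUI -cS2 -cardsUI.
have -> : (S1 :|: S0) :&: S2 = set0.
  apply/setP => S; rewrite [RHS]inE; apply/negP; rewrite inE => /andP[SS /imsetP[T _ ST]].
  have yS : y \in S by rewrite ST setU11.
  by move: SS; rewrite !inE => /orP[/ny1|/ny0]; rewrite yS.
rewrite cards0 addn0; apply: subset_leq_card; apply/subsetP => S.
rewrite !inE => /orP[/orP[]|/imsetP[T]]; [exact: shatters_sub|exact: shatters_sub|].
rewrite !inE => /andP[T1 T0] ->; have yT := ny1 _ T1.
apply/shattersP => D DT; case: (boolP (y \in D)) => yD.
  have /shattersP /(_ (D :\ y)) [|E] := T1.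
    apply/subsetP => a; rewrite !inE => /andP[ay aD].
    by have := subsetP DT a aD; rewrite !inE (negbTE ay).
  rewrite inE => /andP[EF yE] ET; exists E => //.
  apply/setP => a; rewrite !inE; have [->|ay] := eqVneq a y; first by rewrite yE yD.
  by have /setP/(_ a) := ET; rewrite !inE ay.
have /shattersP /(_ D) [|E] := T0.
  apply/subsetP => a aD; have := subsetP DT a aD; rewrite !inE.
  by have [ay|//] := eqVneq a y; rewrite -ay aD in yD.
rewrite inE => /andP[EF yE] ET; exists E => //.
apply/setP => a; rewrite !inE; have [->|ay] := eqVneq a y.
  by rewrite (negbTE yE) (negbTE yD).
by have /setP/(_ a) := ET; rewrite !inE.
Qed.

Lemma sum_expr_card (R : comNzRingType) (z : R) :
  \sum_(S : {set Y}) z ^+ #|S| = (1 + z) ^+ #|Y|.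
Proof.
have -> : (1 + z) ^+ #|Y| = \prod_(y : Y) (z + 1) by rewrite prodr_const addrC.
rewrite bigA_distr; apply: eq_bigr => S _.
by rewrite -big_mkcondr /= prodr_const.
Qed.

(** A generating-function form that avoids sums of binomials: each shattered set weighs at least
    [z ^+ d], out of a total of [(1 + z) ^+ #|Y|]. *)
Lemma sauer_shelah_bound (R : realFieldType) (z : R) (d : nat) F :
  0 < z <= 1 -> (forall S, shatters F S -> (#|S| <= d)%N) ->
  #|F|%:R * z ^+ d <= (1 + z) ^+ #|Y|.
Proof.
move=> /andP[z0 z1] Fd; rewrite -sum_expr_card.
apply: (@le_trans _ _ (\sum_(S in [set S | shatters F S]) z ^+ d)).
  by rewrite sumr_const -[leRHS]mulr_natl ler_wpM2r ?exprn_ge0 ?ler_nat ?sauer_shelah // ltW.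
rewrite [leRHS](bigID (mem [set S | shatters F S])) /= -[leLHS]addr0 lerD //.
  apply: ler_sum => S; rewrite inE => /Fd Sd; exact: ler_wiXn2l (ltW z0) z1 _ _ Sd.
by apply: sumr_ge0 => S _; rewrite exprn_ge0 // ltW.
Qed.

End SauerShelah.

(** * Shattering by a linear space of functions *)

Lemma exists_orthogonal (F : fieldType) (T : finType) (S : {set T}) (m : nat)
    (f : 'I_m -> T -> F) : (m < #|S|)%N ->
  exists w : T -> F, (exists2 y, y \in S & w y != 0) /\
    forall i, \sum_(y in S) w y * f i y = 0.
Proof.
move=> mS; pose A : 'M[F]_(#|S|, m) := \matrix_(i, j) f j (enum_val i).
have kA : kermx A != 0.
  rewrite -mxrank_eq0 mxrank_ker subn_eq0 -ltnNge.
  exact: leq_ltn_trans (rank_leq_col A) mS.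
have /rowV0Pn [r rA rn0] := kA.
have [i ri] : exists i, r 0 i != 0.
  apply/existsP; apply: contraR rn0; rewrite negb_exists => /forallP h.
  by apply/eqP/rowP => i; rewrite mxE; apply/eqP; rewrite -[_ == _]negbK h.
have iS := enum_valP i.
exists (fun y => r 0 (enum_rank_in iS y)); split.
  by exists (enum_val i) => //; rewrite enum_valK_in.
move=> j; move/sub_kermxP/rowP/(_ j): rA; rewrite !mxE => rA.
rewrite -[RHS]rA big_enum_val /=; apply: eq_bigr => k _.
by rewrite enum_valK_in !mxE.
Qed.

(** A larger [S] carries a nonzero [w] orthogonal to a basis of [U] and to [th], which accounts for
    the extra 1. The sign pattern of [w] is realised by some [u], against orthogonality. *)
Lemma shatters_dim (R : realType) (V Y : finType) (U : {vspace {ffun V -> R^o}})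
    (pr : Y -> V) (th : Y -> R) (F : {set {set Y}}) (S : {set Y}) :
  (forall A, A \in F ->
     exists2 u, u \in U & forall y, (y \in A) = (th y < u (pr y))) ->
  shatters F S -> (#|S| <= (\dim U).+1)%N.
Proof.
move=> FU /shattersP FS; rewrite leqNgt; apply/negP => dS.
pose f (i : 'I_(\dim U).+1) (y : Y) : R :=
  if unlift ord0 i is Some j then (vbasis U)`_j (pr y) else th y.
have [w [[y0 y0S wy0] worth]] := @exists_orthogonal _ _ S _ f dS.
have orthU u : u \in U -> \sum_(y in S) w y * (u (pr y) - th y) = 0.
  move=> uU; under eq_bigr do rewrite mulrBr.
  rewrite sumrB; have := worth ord0.
  under eq_bigr do rewrite /f unlift_none.
  move=> ->; rewrite subr0 (coord_vbasis uU).
  under eq_bigr do rewrite sum_ffunE mulr_sumr.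
  rewrite exchange_big big1 // => i _.
  have h : \sum_(y in S) w y * (vbasis U)`_i (pr y) = 0.
    by rewrite -[RHS](worth (lift ord0 i)); apply: eq_bigr => y _; rewrite /f liftK.
  rewrite -[RHS](mulr0 (coord (vbasis U) i u)) -[in RHS]h mulr_sumr.
  by apply: eq_bigr => y _; rewrite !ffunE /GRing.scale /=; ring.
(* For [u] realising the trace [{w' > 0}] all terms are nonnegative, and positive where [w' > 0].
   Only this side is strict, so [w] and [- w] are both treated. *)
have nonpos (w' : Y -> R) : (forall u, u \in U ->
    \sum_(y in S) w' y * (u (pr y) - th y) = 0) -> forall y, y \in S -> w' y <= 0.
  move=> w'0 y yS; rewrite leNgt; apply/negP => wy.
  have [|A AF AS] := FS [set y in S | 0 < w' y].
    by apply/subsetP => z; rewrite inE => /andP[].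
  have [u uU uA] := FU A AF.
  have sgn z : z \in S -> (0 < w' z) = (th z < u (pr z)).
    by move=> zS; have /setP/(_ z) := AS; rewrite !inE zS andbT uA.
  have pos z : z \in S -> 0 <= w' z * (u (pr z) - th z).
    move=> zS; have := sgn z zS; case: ltrP => wz; case: ltrP => uz // _.
      by rewrite mulr_ge0 ?subr_ge0 // ltW.
    by rewrite mulr_le0 ?subr_le0.
  have /eqP := psumr_eq0P pos (w'0 u uU) yS.
  by rewrite mulf_eq0 gt_eqF // subr_eq0 gt_eqF // -sgn.
have wle := nonpos w orthU y0 y0S.
have wge : - w y0 <= 0.
  apply: (nonpos (fun y => - w y)) y0S => u uU.
  under eq_bigr do rewrite mulNr.
  by rewrite sumrN orthU // oppr0.
by move: wy0; rewrite eq_le wle -oppr_le0 wge.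
Qed.

(** * Counting grid points near a subspace *)

Section Grid.
Variables (R : realType) (V : finType) (M : nat).
Hypothesis M0 : (0 < M)%N.
Implicit Types x : {ffun V -> 'I_M}.

Definition grid_mean : R := M.-1%:R / 2.

Definition grid x (v : V) : R := (x v)%:R - grid_mean.

Let z : R := M%:R^-1.
Let l : R := ln M%:R.

Let M0R : 0 < M%:R :> R. Proof. by rewrite ltr0n. Qed.

Let expl : expR l = M%:R. Proof. by rewrite lnK // posrE. Qed.

Let zE : z = expR (- l). Proof. by rewrite expRN expl. Qed.

Let z01 : 0 < z <= 1.
Proof. by rewrite invr_gt0 M0R invf_le1 // ler1n. Qed.

Let Y : finType := (V * 'I_M)%type.
(** The threshold of [(v, j)] lies half a step above the grid value with index [j], so those below
    [u v] encode the rounding of [u v]. *)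
Let th (y : Y) : R := y.2%:R + 2^-1 - grid_mean.

(* Up to the choice of at most [2 * D] coordinates, a grid point within distance
   [D] of [u] is the rounding of [u], which is encoded by the set of thresholds
   lying below the coordinates of [u]. *)
Lemma card_grid_near_subspace (U : {vspace {ffun V -> R^o}}) (D : R)
    (X : {set {ffun V -> 'I_M}}) :
  (forall x, x \in X -> exists2 u, u \in U & \sum_v `|grid x v - u v| <= D) ->
  #|X|%:R <= expR (ln M%:R * ((\dim U).+1%:R + 2 * D) + 2 * #|V|%:R).
Proof.
move=> XU; have /andP[z0 z1] := z01.
have Mz : M%:R * z = 1 by rewrite mulfV // gt_eqF.
pose F := [set A : {set Y} |
  `[< exists2 u, u \in U & forall y, (y \in A) = (th y < u y.1) >]].
(* A coordinate at which [x] is not the rounding encoded by [A]; for the code of [u] it costs at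
   least 1/2 of the distance. *)
pose mism (A : {set Y}) v (i : 'I_M) := [exists j : 'I_M, ((v, j) \in A) != (j < i)%N].
have near x : x \in X -> exists2 A, A \in F & #|[set v | mism A v (x v)]|%:R <= 2 * D.
  move=> /XU [u uU uD]; exists [set y : Y | th y < u y.1].
    by rewrite inE; apply/asboolP; exists u => // y; rewrite inE.
  have far v : mism [set y : Y | th y < u y.1] v (x v) -> 2^-1 <= `|grid x v - u v|.
    apply: contraTT; rewrite -ltNge => h; rewrite negb_exists; apply/forallP => j.
    rewrite negbK inE /th /=; apply/eqP.
    move: h; rewrite ltr_distl /grid => /andP[h1 h2].
    case: (ltnP j (x v)) => jx.
      by move: jx; rewrite -(ler_nat R) -natr1 => jx; apply/idP; lra.
    by move: jx; rewrite -(ler_nat R) => jx; apply/negbTE; rewrite -leNgt; lra.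
  set T := [set v | _].
  have : \sum_(v in T) 2^-1 <= D.
    apply: le_trans uD; rewrite [leRHS](bigID (mem T)) /= -[leLHS]addr0 lerD //.
      by apply: ler_sum => v; rewrite inE => /far.
    by apply: sumr_ge0 => v _; exact: normr_ge0.
  rewrite sumr_const -mulr_natr; lra.
have FU : #|F|%:R * z ^+ (\dim U).+1 <= expR #|V|%:R.
  apply: le_trans (sauer_shelah_bound z01 (d := (\dim U).+1) _) _.
    move=> S; apply: (@shatters_dim R V Y U fst th) => A.
    by rewrite inE => /asboolP.
  rewrite card_prod card_ord; apply: le_trans (lerXn2r _ _ _ (expR_ge1Dx z)) _.
  - by rewrite nnegrE addr_ge0 // ltW.
  - by rewrite nnegrE expR_ge0.
  by rewrite -expRM_natl natrM -mulrA Mz mulr1.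
(* At most one [i] matches [A] at [v]; the at most [M] others contribute [1 / M] each. *)
have column A v : \sum_i (if mism A v i then z else 1) <= 2.
  apply: (@le_trans _ _ (\sum_(i < M) z + \sum_(i < M | ~~ mism A v i) 1)).
    rewrite [X in _ <= _ + X]big_mkcond -big_split /=; apply: ler_sum => i _.
    by case: (mism A v i); rewrite /= ?addr0 // lerDr ltW.
  rewrite sumr_const card_ord -[z *+ M]mulr_natl Mz.
  rewrite -[leRHS](natrD _ 1 1) lerD2l sumr_const.
  rewrite (ler_nat R _ 1); apply/card_le1_eqP => i i' /existsPn h /existsPn h'.
  have e (j : 'I_M) : (j < i)%N = (j < i')%N.
    by have := h j; have := h' j; rewrite !negbK => /eqP <- /eqP <-.
  apply/val_inj/eqP; rewrite eqn_leq leqNgt -e ltnn /=.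
  by rewrite leqNgt e ltnn.
(* Weighting replaces the choice of mismatched coordinates: each [A] has total weight at most
   [2 ^+ #|V|], and a point of [X] has weight at least [M] to the power [- 2 * D] for some [A] in
   [F]. *)
pose wt A x := \prod_v (if mism A v (x v) then z else 1).
have wt0 A x : 0 <= wt A x.
  by apply: prodr_ge0 => v _; case: ifP => _; rewrite ?ler01 // ltW.
have sum_wt A : \sum_x wt A x <= 2 ^+ #|V|.
  rewrite -(bigA_distr_bigA (fun v i => if mism A v i then z else 1)) /=.
  have -> : 2 ^+ #|V| = \prod_(v : V) (2 : R) by rewrite prodr_const.
  apply: ler_prod => v _; rewrite column andbT.
  by apply: sumr_ge0 => i _; case: ifP => _; rewrite ?ler01 // ltW.
have le_wt : #|X|%:R * expR (- (l * (2 * D))) <= \sum_(A in F) \sum_x wt A x.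
  rewrite mulrC mulr_natr -sumr_const exchange_big /=.
  rewrite [leRHS](bigID (mem X)) /= -[leLHS]addr0 lerD //; last first.
    by apply: sumr_ge0 => x _; apply: sumr_ge0.
  apply: ler_sum => x /near [A AF AD]; rewrite (bigD1 A) //= -[leLHS]addr0 lerD //.
    rewrite /wt -big_mkcond /= prodr_const zE -expRM_natl ler_expR.
    rewrite mulrN lerN2 mulrC ler_wpM2l ?ln_ge0 ?ler1n //.
    by apply: le_trans AD; rewrite ler_nat; apply: subset_leq_card; apply/subsetP => v; rewrite !inE.
  by apply: sumr_ge0.
have F2 : #|X|%:R * expR (- (l * (2 * D))) <= #|F|%:R * 2 ^+ #|V|.
  apply: le_trans le_wt _; rewrite mulrC mulr_natr -sumr_const.
  by apply: ler_sum => A _.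
have two : 2 ^+ #|V| <= expR #|V|%:R :> R.
  have := expR_ge1Dx (1 : R); rewrite -[_ #|V|%:R]/(expR _) => h.
  rewrite -[#|V|%:R]mulr1 expRM_natl lerXn2r ?nnegrE ?expR_ge0 //.
move: FU; rewrite zE -expRM_natl mulrN expRN -/l => FU.
have -> : ln M%:R * ((\dim U).+1%:R + 2 * D) + 2 * #|V|%:R =
    #|V|%:R + (\dim U).+1%:R * l + #|V|%:R + l * (2 * D) by rewrite /l; ring.
move: F2; rewrite expRN !expRD ler_pdivrMr ?expR_gt0 // => F2.
apply: le_trans F2 _; rewrite ler_pM2r ?expR_gt0 //.
rewrite ler_pM ?exprn_ge0 ?ler0n //.
by rewrite -ler_pdivrMr ?expR_gt0.
Qed.

(** * Chernoff bound on the grid *)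

Lemma sum_grid_values : \sum_(i < M) ((i : nat)%:R - grid_mean) = 0.
Proof.
rewrite sumrB sumr_const card_ord -natr_sum.
have := bin2_sum M; rewrite big_mkord => ->.
have -> : ('C(M, 2))%:R = M%:R * M.-1%:R / 2 :> R.
  by rewrite -natrM bin2 -[X in _ = X%:R / _](odd_double_half (M * M.-1)) oddM
    -subn1 oddB // addbT andbN add0n -mul2n natrM mulrAC mulfV ?mul1r // pnatr_eq0.
by rewrite -mulr_natl /grid_mean; ring.
Qed.

(** From [1 - y <= expR (- y)] and [(1 - y) * (1 + y + 2 * y ^+ 2) = 1 + y ^+ 2 * (1 - 2 * y)]. *)
Lemma expR_le_quadratic (y : R) : y <= 2^-1 -> expR y <= 1 + y + 2 * y ^+ 2.
Proof.
move=> y2; have y1 : 0 < 1 - y by lra.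
have := expR_ge1Dx (- y); rewrite expRN => h.
have e0 := expR_gt0 y.
have : (1 - y) * expR y <= 1.
  by rewrite -ler_pdivlMr // div1r.
move=> h1; rewrite -(ler_pM2l y1); apply: le_trans h1 _.
have : 0 <= y ^+ 2 * (1 - 2 * y) by rewrite mulr_ge0 ?sqr_ge0 //; lra.
by move=> h2; rewrite -subr_ge0; apply: le_trans h2 _; rewrite le_eqVlt; apply/orP; left; apply/eqP; ring.
Qed.

(** Bounds a moment generating function: the linear terms cancel by centring, and centred values are
    at most [M] in absolute value. *)
Lemma grid_mgf (b : R) : `|b| * M%:R <= 2^-1 ->
  \sum_(i < M) expR (b * ((i : nat)%:R - grid_mean)) <=
  M%:R * expR (2 * (b * M%:R) ^+ 2).
Proof.
move=> b2.
have vM (i : 'I_M) : `|(i : nat)%:R - grid_mean| <= M%:R.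
  have iM : (i : nat)%:R <= M%:R :> R by rewrite ler_nat ltnW.
  have i0 : 0 <= (i : nat)%:R :> R by rewrite ler0n.
  have m0 : 0 <= M.-1%:R :> R by rewrite ler0n.
  have mM : M.-1%:R <= M%:R :> R by rewrite ler_nat leq_pred.
  by rewrite ler_norml /grid_mean; apply/andP; split; lra.
have bv (i : 'I_M) : `|b * ((i : nat)%:R - grid_mean)| <= `|b * M%:R|.
  by rewrite !normrM ler_wpM2l // (ger0_norm (ltW M0R)).
apply: (@le_trans _ _ (\sum_(i < M) (1 + b * ((i : nat)%:R - grid_mean) + 2 * (b * M%:R) ^+ 2))).
  apply: ler_sum => i _.
  apply: le_trans (expR_le_quadratic _) _.
    apply: le_trans (ler_norm _) _; apply: le_trans (bv i) _.
    by rewrite normrM (ger0_norm (ltW M0R)).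
  rewrite lerD2l ler_pM2l // -[leLHS]real_normK ?num_real // -[leRHS]real_normK ?num_real //.
  by rewrite lerXn2r ?nnegrE.
rewrite !big_split /= -mulr_sumr sum_grid_values mulr0 addr0 !sumr_const card_ord.
rewrite -[X in _ + X]mulr_natl -[X in X <= _]/(M%:R + _).
have := expR_ge1Dx (2 * (b * M%:R) ^+ 2); rewrite -(ler_pM2l M0R) => h.
by apply: le_trans h; rewrite mulrDr mulr1.
Qed.

Lemma card_grid_deviation (a : V -> R) (eta : R) :
  (forall v, `|a v| <= 1) -> 0 <= eta <= 2 ->
  #|[set x | eta * #|V|%:R < \sum_v grid x v * a v]|%:R <=
  M%:R ^+ #|V| * expR (- (eta ^+ 2 / (8 * M%:R ^+ 2)) * #|V|%:R).
Proof.
move=> a1 /andP[e0 e2]; set X := [set x | _].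
have M1 : 1 <= M%:R :> R by rewrite ler1n.
(* Minimises the exponent per coordinate, [2 * (s * M) ^+ 2 - s * eta]; [eta <= 2] ensures
   [s * M <= 1 / 2], as [grid_mgf] requires. *)
pose s : R := eta / (4 * M%:R ^+ 2).
have s0 : 0 <= s by rewrite divr_ge0 // mulr_ge0 // exprn_ge0.
have sM : s * M%:R <= 2^-1.
  have -> : s * M%:R = eta / 4 / M%:R by rewrite /s; field; rewrite gt_eqF.
  rewrite ler_pdivrMr //; lra.
have : #|X|%:R * expR (s * (eta * #|V|%:R)) <=
    \sum_x expR (s * \sum_v grid x v * a v).
  rewrite mulrC [leLHS]mulr_natr -[leLHS]sumr_const [leRHS](bigID (mem X)) /= -[leLHS]addr0 lerD //.
    by apply: ler_sum => x; rewrite inE => /ltW h; rewrite ler_expR ler_wpM2l.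
  by apply: sumr_ge0 => x _; exact: expR_ge0.
have -> : \sum_x expR (s * \sum_v grid x v * a v) =
    \prod_v \sum_(i < M) expR ((s * a v) * ((i : nat)%:R - grid_mean)).
  rewrite (bigA_distr_bigA (fun v (i : 'I_M) => expR (s * a v * ((i : nat)%:R - grid_mean)))) /=.
  apply: eq_bigr => x _; rewrite mulr_sumr expR_sum; apply: eq_bigr => v _.
  by congr expR; rewrite /grid; ring.
have le_mgf : \prod_v \sum_(i < M) expR ((s * a v) * ((i : nat)%:R - grid_mean)) <=
    \prod_(v : V) (M%:R * expR (2 * (s * M%:R) ^+ 2)).
  apply: ler_prod => v _; apply/andP; split.
    by apply: sumr_ge0 => i _; exact: expR_ge0.
  have sa : `|s * a v| * M%:R <= s * M%:R.
    by rewrite ler_pM2r // normrM (ger0_norm s0) ler_piMr.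
  apply: le_trans (grid_mgf (le_trans sa sM)) _.
  rewrite ler_pM2l // ler_expR ler_pM2l // -[leLHS]real_normK ?num_real //.
  apply: lerXn2r; rewrite ?nnegrE ?normr_ge0 //; first exact: mulr_ge0 s0 (ltW M0R).
  by rewrite normrM (ger0_norm (ltW M0R)).
move=> /le_trans /(_ le_mgf); rewrite prodr_const exprMn -expRM_natl.
rewrite -ler_pdivlMr ?expR_gt0 // -mulrA -expRN -expRD => h.
apply: le_trans h _; rewrite ler_pM2l ?exprn_gt0 // ler_expR.
rewrite le_eqVlt; apply/orP; left; apply/eqP; rewrite /s; field.
by rewrite gt_eqF.
Qed.

End Grid.

(** * Combination of the two counts and choice of the constants *)

Lemma core_grid_bound (R : realType) (V : finType) (C : {set {set V}})
    (t M : nat) (beta eta : R) :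
  ideal R C -> cover_minimal t C -> (0 < t)%N -> (0 < M)%N ->
  6 <= beta * ln M%:R -> 4 <= beta * #|V|%:R -> 0 <= eta <= 2 ->
  t.+1%:R * (t%:R * eta) = beta / 8 ->
  (rank_blocker_of_size R t C)%:R <= (1 - beta) * #|V|%:R ->
  expR (eta ^+ 2 / (8 * M%:R ^+ 2) * #|V|%:R) <= 2 * #|core C|%:R.
Proof.
move=> idC cmC t0 M0 bM bn eta02 etaE rk.
set n : R := #|V|%:R in bn rk *; set kap := eta ^+ 2 / _.
have t0R : 0 < t%:R :> R by rewrite ltr0n.
have Mn0 : 0 < M%:R ^+ #|V| :> R by rewrite exprn_gt0 // ltr0n.
pose a (A : {set V}) v : R := (v \in A)%:R - t%:R^-1.
have a1 A v : `|a A v| <= 1.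
  have it0 : 0 <= t%:R^-1 :> R by rewrite invr_ge0 ltW.
  have it1 : t%:R^-1 <= 1 :> R by rewrite invf_le1 // ler1n.
  by rewrite /a ler_norml; case: (v \in A) => /=; apply/andP; split; lra.
pose Dev A := [set x : {ffun V -> 'I_M} | eta * n < \sum_v grid R x v * a A v].
pose X := ~: \bigcup_(A in core C) Dev A.
(* Off all deviation sets [gam = eta * n + g(V) / t] is admissible, and then
   [t * gam - g(V) = t * eta * n]. *)
have Xnear x : x \in X -> exists2 u, u \in min_cover_space R C t &
    \sum_v `|grid R x v - u v| <= beta / 8 * n.
  move=> xX; have [|u uU uD] := @core_l1_distance R V C t idC cmC (grid R x)
      (eta * n + t%:R^-1 * \sum_v grid R x v).
    move=> A Ac; move: xX; rewrite inE => /bigcupP h.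
    have : ~~ (eta * n < \sum_v grid R x v * a A v).
      by apply/negP => xA; apply: h; exists A => //; rewrite inE.
    rewrite -leNgt; under eq_bigr do rewrite mulrBr.
    rewrite sumrB -mulr_suml lerBlDr [X in _ + X]mulrC.
    by apply: le_trans; rewrite [leLHS]big_mkcond le_eqVlt; apply/orP; left;
      apply/eqP; apply: eq_bigr => v _; case: ifP => _; rewrite ?mulr1 ?mulr0.
  exists u => //; apply: le_trans uD _; rewrite -etaE le_eqVlt; apply/orP; left.
  by apply/eqP; field; rewrite gt_eqF.
have Xle : #|X|%:R <= M%:R ^+ #|V| * expR (- n).
  apply: le_trans (card_grid_near_subspace M0 Xnear) _.
  have MnE : M%:R ^+ #|V| = expR (ln M%:R * n) :> R.
    by rewrite mulrC expRM_natl lnK // posrE ltr0n.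
  rewrite MnE -expRD ler_expR.
  have dimE : (\dim (min_cover_space R C t))%:R <= (1 - beta) * n by exact: rk.
  have l0 : 0 <= ln M%:R :> R by rewrite ln_ge0 // ler1n.
  have n0 : 0 <= n by rewrite ler0n.
  rewrite -natr1.
  (* The 1 added to the dimension is absorbed by [beta * n / 4]. The exponent becomes
     [(1 - beta / 2) * ln M * n + 2 * n], at most [(ln M - 1) * n] since [beta * ln M >= 6]. *)
  apply: (@le_trans _ _ (ln M%:R * ((1 - beta) * n + beta * n / 4 + 2 * (beta / 8 * n)) + 2 * n)).
    rewrite lerD2r ler_wpM2l //; lra.
  have := ler_wpM2r n0 bM; lra.
have Dle A : #|Dev A|%:R <= M%:R ^+ #|V| * expR (- kap * n).
  exact: card_grid_deviation.
have tot : M%:R ^+ #|V| <= #|core C|%:R * (M%:R ^+ #|V| * expR (- kap * n)) +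
    M%:R ^+ #|V| * expR (- n).
  have cT : #|\bigcup_(A in core C) Dev A|%:R + #|X|%:R = M%:R ^+ #|V| :> R.
    by rewrite -natrD cardsC card_ffun card_ord natrX.
  rewrite -[leLHS]cT; apply: lerD => //.
  rewrite mulrC [leRHS]mulr_natr -[leRHS]sumr_const.
  apply: (@le_trans _ _ (\sum_(A in core C) #|Dev A|%:R)); last exact: ler_sum.
  rewrite -natr_sum ler_nat.
  elim/big_rec2: _ => [|A k E _ Ek]; first by rewrite cards0.
  by apply: leq_trans (leq_card_setU _ _) _; rewrite leq_add2l.
have half : expR (- n) <= 2^-1.
  have n1 : 1 <= n by rewrite ler1n lt0n; apply/eqP => V0; move: bn; rewrite /n V0 mulr0; lra.
  rewrite expRN lef_pV2 ?posrE ?expR_gt0 //; apply: le_trans (expR_ge1Dx n); lra.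
move: tot; rewrite mulrCA -mulrDr -[leLHS]mulr1 ler_pM2l // mulNr (expRN (kap * n)) => tot.
have e0 := expR_gt0 (kap * n).
have : 2^-1 <= #|core C|%:R / expR (kap * n) by lra.
rewrite ler_pdivlMr //; lra.
Qed.

Theorem theorem5p4 (R : realType) (tau : nat) (beta : R)
    (htau : (3 <= tau)%N) (hbeta : 0 < beta < 1) :
  exists theta : R, 0 < theta /\
    forall (V : finType) (C : {set {set V}}),
      clutter C -> ideal R C -> cover_minimal tau C ->
      (rank_blocker_of_size R tau C)%:R <= (1 - beta) * #|V|%:R ->
      expR (theta * #|V|%:R) <= #|core C|%:R.
Proof.
have /andP[b0 b1] := hbeta.
have t0 : (0 < tau)%N by apply: leq_trans htau.
have t0R : 1 <= tau%:R :> R by rewrite ler1n.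
have t1R : 1 <= tau.+1%:R :> R by rewrite ler1n.
have tt : 1 <= tau.+1%:R * tau%:R :> R by rewrite -natrM ler1n muln_gt0.
have [M [M0 bM]] : exists M, (0 < M)%N /\ 6 <= beta * ln M%:R.
  have e0 := expR_gt0 (6 / beta).
  exists (Num.bound (expR (6 / beta))).
  have := archi_boundP (ltW e0) => h.
  have MR : 0 < (Num.bound (expR (6 / beta)))%:R :> R by apply: lt_trans h.
  split; first by rewrite -(ltr0n R).
  by rewrite mulrC -ler_pdivrMr // -ler_expR lnK ?posrE // ltW.
pose eta := beta / 8 / (tau.+1%:R * tau%:R).
have eta0 : 0 < eta by rewrite !divr_gt0 //; lra.
have eta2 : eta <= 2 by rewrite ler_pdivrMr; lra.
have etaE : tau.+1%:R * (tau%:R * eta) = beta / 8.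
  by rewrite /eta; field; rewrite !gt_eqF //; lra.
pose kap := eta ^+ 2 / (8 * M%:R ^+ 2).
have kap0 : 0 < kap.
  rewrite divr_gt0 //; first exact: exprn_gt0.
  by rewrite mulr_gt0 // exprn_gt0 // ltr0n.
have ln2 : 0 < ln 2 :> R by rewrite ln_gt0 // ltr1n.
(* From [n0] on, [4 <= beta * n] and [ln 2 <= kap * n / 2]; the latter absorbs the factor 2 in
   [core_grid_bound]. *)
pose n0 : R := 4 / beta + 2 * ln 2 / kap.
have n00 : 0 < n0 by apply: addr_gt0; apply: divr_gt0 => //; exact: mulr_gt0.
(* The first bound serves large [n]; for [n < n0] the second gives
   [expR (theta * n) <= 2 <= #|core C|]. *)
exists (Num.min (kap / 2) (ln 2 / n0)); split.
  by rewrite lt_min; apply/andP; split; exact: divr_gt0.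
move=> V C _ idC cmC rk; set n : R := #|V|%:R.
have nn : 0 <= n by rewrite ler0n.
have [large|small] := lerP n0 n; last first.
  apply: (@le_trans _ _ 2); last by rewrite ler_nat (core_ge2 idC cmC) // ltnW.
  rewrite -[leRHS](@lnK R) ?posrE // ler_expR.
  apply: (@le_trans _ _ (ln 2 / n0 * n)).
    by rewrite ler_wpM2r // ge_min lexx orbT.
  by rewrite mulrAC ler_pdivrMr // ler_pM2l // ltW.
have n4 : 4 / beta <= n.
  by apply: le_trans large; rewrite lerDl; apply: divr_ge0; [exact: mulr_ge0 (ltW ln2)|exact: ltW].
have nk : 2 * ln 2 / kap <= n.
  by apply: le_trans large; rewrite lerDr divr_ge0 // ltW.
have main : expR (kap * n) <= 2 * #|core C|%:R.
  apply: (core_grid_bound idC cmC t0 M0 bM) etaE rk.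
    by rewrite mulrC -ler_pdivrMr.
  by rewrite (ltW eta0) eta2.
rewrite -(ler_pM2l (ltr0Sn R 1)); apply: le_trans main.
rewrite -[X in X * _ <= _](@lnK R) ?posrE // -expRD ler_expR.
apply: (@le_trans _ _ (ln 2 + kap / 2 * n)).
  by rewrite lerD2l ler_wpM2r // ge_min lexx.
move: nk; rewrite ler_pdivrMr //; lra.
Qed.
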